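(* A tree $T$ is a $K_1$-corona if and only if it is domination-unmixed.
   Context: All graphs are finite and simple (no loops, no multi-edges). A $K_1$-corona of a graph $G$ with vertex set $\{X_1,\ldots,X_d\}$ and edge set $E$ is the graph obtained by adding a ''whisker'' to each vertex of $G$, i.e., it is a graph with vertex set $\{X_1,\ldots,X_d,Y_1,\ldots,Y_d\}$ (with $Y_1,\ldots,Y_d$ new distinct vertices) and edge set $E\cup\{X_1Y_1,\ldots,X_dY_d\}$; a graph is called a $K_1$-corona if it is a $K_1$-corona of some graph. A dominating set for a graph is a subset $V'$ of the vertex set such that every vertex is either in $V'$ or adjacent to a vertex in $V'$; it is minimal if it does not properly contain another dominating set. A graph is domination-unmixed if all its minimal dominating sets have the same size.
   Formalization: The tree is assumed to have at least two vertices: the one-vertex tree is domination-unmixed but is not a K_1-corona, since a K_1-corona has an even number of vertices. *)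

(* Defs.v *)
From mathcomp Require Import all_boot.

Set Implicit Arguments.
Unset Strict Implicit.
Unset Printing Implicit Defensive.

Record sgraph := SGraph {
  vertex :> finType;
  edge : rel vertex;
  edge_sym : symmetric edge;
  edge_irrefl : irreflexive edge
}.

Definition isomorphic (G H : sgraph) : Prop :=
  exists2 f : G -> H, bijective f & {mono f : x y / edge x y}.

Definition connected (G : sgraph) : Prop :=
  forall x y : G, connect (@edge G) x y.

(* A cycle of a graph has length at least 3: [ucycle] also accepts the empty
   sequence and the closed walk [:: x; y] going back and forth on one edge. *)
Definition acyclic (G : sgraph) : Prop :=
  forall c : seq G, 2 < size c -> ~ ucycle (@edge G) c.

Definition is_tree (G : sgraph) : Prop :=
  [/\ 0 < #|G|, connected G & acyclic G].

(* In the corona, [inl x] is the original vertex X and [inr x] the end Y of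
   the whisker attached to it. *)
Definition corona_edge (G : sgraph) : rel (G + G) :=
  fun u v => match u, v with
  | inl x, inl y => edge x y
  | inl x, inr y => x == y
  | inr x, inl y => x == y
  | inr _, inr _ => false
  end.

Lemma corona_edge_sym (G : sgraph) : symmetric (@corona_edge G).
Proof. by move=> [x|x] [y|y] //=; rewrite 1?edge_sym // eq_sym. Qed.

Lemma corona_edge_irrefl (G : sgraph) : irreflexive (@corona_edge G).
Proof. by move=> [x|x] //=; rewrite edge_irrefl. Qed.

Definition corona (G : sgraph) : sgraph :=
  SGraph (@corona_edge_sym G) (@corona_edge_irrefl G).

Definition is_K1_corona (G : sgraph) : Prop :=
  exists H : sgraph, isomorphic G (corona H).

Definition dominating (G : sgraph) (D : {set G}) : bool :=
  [forall v, (v \in D) || [exists u in D, edge v u]].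

Definition domination_unmixed (G : sgraph) : Prop :=
  forall D1 D2 : {set G},
    minset (@dominating G) D1 -> minset (@dominating G) D2 -> #|D1| = #|D2|.

(* Main.v *)
Require Import Defs.
From mathcomp Require Import all_boot.

(** An independent dominating set is a minimal dominating set, so in a
    domination-unmixed graph it is no larger than any dominating set.  Let [L]
    be the leaves of a forest without isolated vertices, [S] their neighbours
    and [R] the other vertices, so that [#|S| <= #|L|].  If [R] is nonempty, the
    forest it induces has a vertex [r] with at most one neighbour in [R].
    A maximal independent set [I] containing [L] and [r], and also some vertex
    of [R] at distance two from [r] inside [R] if there is one, gives a strictly
    smaller dominating set: replace [L] by [S] and drop [r].  Hence [R] is
    empty; comparing [L] and [S], which both dominate, yields [#|S| = #|L|], and
    the edges from [L] to [S] are the whiskers. *)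

Lemma dominatingP {G : sgraph} {D : {set G}} :
  reflect (forall v, v \notin D -> exists2 u, u \in D & edge v u)
          (dominating D).
Proof.
apply: (iffP forallP) => [domD v vND|domD v].
  by have := domD v; rewrite (negPf vND) => /exists_inP.
by case: (boolP (v \in D)) => //= /domD ?; apply/exists_inP.
Qed.

(** Otherwise every vertex of [R] has two neighbours in [R]. A path starting in [R] can then always
    be extended at its head, and becomes longer than [#|G|]. *)
Lemma acyclic_induced_deg_le1 {G : sgraph} {R : {set G}} {x0 : G} :
  acyclic G -> x0 \in R ->
  exists2 r, r \in R &
    {in R &, forall u v, edge r u -> edge r v -> u = v}.
Proof.
move=> acG x0R.
suff /exists_inP[r rR degr] : [exists r in R, [forall u in R, [forall v in R,
    edge r u ==> edge r v ==> (u == v)]]].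
  exists r => // u v uR vR ru rv; apply/eqP.
  by move/forall_inP: degr => /(_ _ uR)/forall_inP/(_ _ vR); rewrite ru rv.
apply: contraT => /exists_inPn degR.
have long n : exists x p,
    [/\ path (@edge G) x p, uniq (x :: p), x \in R & size p = n].
  elim: n => [|n [x [p [xp Up xR sp]]]]; first by exists x0, [::].
  suff [y [yR xy yNp]] : exists y, [/\ y \in R, edge x y & y \notin p].
    exists y, (x :: p); split=> //; last by rewrite /= sp.
      by rewrite /= edge_sym xy.
    rewrite cons_uniq Up inE negb_or yNp !andbT.
    by apply: contraTneq xy => ->; rewrite edge_irrefl.
  have [u uR] := forall_inPn (degR x xR).
  case/forall_inPn => v vR; rewrite !negb_imply => /and3P[xu xv uDv].
  (* A neighbour of [x] further along [p] would close a cycle of length at least 3. The default of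
     [head] never matters, as [y \in p]. *)
  have close y : edge x y -> y \in p -> y = head x p.
    move=> xy yp; case: (path.splitP yp) xp Up => -[//|z p1] p2.
    rewrite cat_path -cat_cons cat_uniq => /andP[xp _] /andP[Up _].
    case: (acG (x :: rcons (z :: p1) y)); first by rewrite /= size_rcons.
    by rewrite /ucycle Up andbT /cycle rcons_path xp last_rcons edge_sym.
  have [up|uNp] := boolP (u \in p); last by exists u.
  exists v; split=> //; apply: contraNN uDv => vp.
  by rewrite (close u xu up) (close v xv vp).
have [x [p [_ Up _ sp]]] := long #|G|.
by have := max_card [in x :: p]; rewrite (card_uniqP Up) /= sp ltnn.
Qed.

Definition independent {G : sgraph} (I : {set G}) : bool :=
  [forall u in I, forall v in I, ~~ edge u v].

Lemma independentP {G : sgraph} {I : {set G}} :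
  reflect {in I &, forall u v, ~~ edge u v} (independent I).
Proof.
apply: (iffP forall_inP) => [indI u v uI vI|indI u uI].
  exact: (forall_inP (indI u uI)).
by apply/forall_inP => v; apply: indI.
Qed.

Lemma independent_dominating_minset {G : sgraph} {I : {set G}} :
  independent I -> dominating I -> minset (@dominating G) I.
Proof.
move=> /independentP indI domI; apply/minsetP; split=> // D domD sDI.
apply/eqP; rewrite eqEsubset sDI; apply/subsetP => v vI.
apply: contraT => /(dominatingP domD)[u uD vu].
by have := indI v u vI (subsetP sDI u uD); rewrite vu.
Qed.

(** A vertex not dominated by a maximal independent set could be added to it. *)
Lemma independent_extension {G : sgraph} {K : {set G}} :
  independent K ->
  exists I : {set G}, [/\ K \subset I, independent I & dominating I].
Proof.
move=> indK; have [I /maxsetP[indI maxI] sKI] := maxset_exists indK.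
exists I; split=> //; apply/dominatingP => v vNI; apply/exists_inP.
apply: contraNT vNI => /exists_inPn vN.
rewrite -(maxI (v |: I)) ?setU11 ?subsetUr //.
move/independentP: indI => indI; apply/independentP => a b.
move=> /setU1P[->|aI] /setU1P[->|bI]; last exact: indI.
- by rewrite edge_irrefl.
- exact: vN.
- by rewrite edge_sym; apply: vN.
Qed.

Lemma unmixed_independent_le {G : sgraph} {I D : {set G}} :
  domination_unmixed G -> independent I -> dominating I -> dominating D ->
  #|I| <= #|D|.
Proof.
move=> unmG indI domI domD.
have [D' minD' /subset_leq_card] := minset_exists domD.
by rewrite (unmG I D') //; apply: independent_dominating_minset.
Qed.

(** A minimal dominating set meets each whisker in exactly one end, so [base], which sends a vertex
    to the index of its whisker, maps it bijectively onto [H]. *)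
Lemma K1_corona_unmixed {G : sgraph} : is_K1_corona G -> domination_unmixed G.
Proof.
case=> H [f [g fK gK] fE].
pose base v := match f v with inl x => x | inr x => x end.
suff cardD (D : {set G}) : minset (@dominating G) D -> #|D| = #|H|.
  by move=> D1 D2 /cardD-> /cardD->.
case/minsetP=> domD minD.
(* If both ends were in [D], the outer end [v] could be deleted: its only neighbour is [u]. *)
have pairN u v x : u \in D -> v \in D -> f u = inl x -> f v = inr x -> False.
  move=> uD vD fu fv.
  have uDv : u \in D :\ v.
    by rewrite !inE uD andbT; apply/eqP => uv; rewrite uv fv in fu.
  suff /minD/(_ (subD1set _ _)) Dv : dominating (D :\ v).
    by rewrite -Dv setD11 in vD.
  apply/dominatingP => w; rewrite !inE negb_and negbK.
  case: eqVneq => [->|wDv /= wND]; first by exists u; rewrite // -fE fu fv /= eqxx.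
  have [z zD wz] := dominatingP domD w wND.
  case: (eqVneq z v) => [zv|zDv]; last by exists z; rewrite // !inE zDv.
  move: wz; rewrite zv -fE fv; case fw: (f w) => [y|//] /= /eqP yx.
  by case/negP: wND; rewrite -(fK w) fw yx -fu fK.
have base_inj : {in D &, injective base}.
  move=> u v uD vD; rewrite /base; apply: contra_eq => uDv.
  have: f u != f v by rewrite (can_eq fK).
  case fu: (f u) => [x|x]; case fv: (f v) => [y|y] fuv; apply/eqP => xy.
  - by rewrite xy eqxx in fuv.
  - by rewrite -xy in fv; apply: (pairN u v x).
  - by rewrite xy in fu; apply: (pairN v u y).
  - by rewrite xy eqxx in fuv.
rewrite -(card_in_imset base_inj) -cardsT; apply: eq_card => x.
rewrite inE; apply/imsetP.
(* An outer end is dominated only by itself or by its inner end. *)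
have [vD|/(dominatingP domD)[u uD]] := boolP (g (inr x) \in D).
  by exists (g (inr x)); rewrite // /base gK.
rewrite -fE gK; case fu: (f u) => [y|//] /= /eqP ->.
by exists u; rewrite // /base fu.
Qed.

(** Attach to each vertex of [S] a chosen neighbour in [L]. The choice is injective because a vertex
    of [L] has only one neighbour, and the cardinality bound makes it exhaust [L]. The base graph is
    the one induced on [S]. *)
Lemma pendant_matching_K1_corona {G : sgraph} {L S : {set G}} :
  L :|: S = setT -> [disjoint L & S] -> independent L ->
  {in L, forall l u v, edge l u -> edge l v -> u = v} ->
  {in S, forall s, exists2 l, l \in L & edge s l} ->
  #|L| <= #|S| -> is_K1_corona G.
Proof.
move=> LS dLS /independentP indL Lpend SL leLS.
pose U : finType := {s : G | s \in S}.
pose eU : rel U := fun x y => edge (val x) (val y).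
have eU_sym : symmetric eU by move=> x y; apply: edge_sym.
have eU_irr : irreflexive eU by move=> x; apply: edge_irrefl.
pose H := SGraph eU_sym eU_irr.
have /fin_all_exists2[lf lfL lfE] (x : U) : exists2 l, l \in L & edge (val x) l.
  exact: SL (valP x).
have lfP x y : edge (val x) (lf y) = (x == y).
  apply/idP/eqP => [xy|->//]; apply: val_inj.
  by apply: (Lpend (lf y)); rewrite // edge_sym.
pose g (z : corona H) : G := match z with inl x => val x | inr x => lf x end.
have gE : {mono g : u v / edge u v}.
  case=> x [] y //=; first exact: lfP.
    by rewrite edge_sym lfP eq_sym.
  by apply/negbTE/indL.
have lf_notin x : lf x \notin S by rewrite (disjointFr dLS).
have g_inj : injective g.
  case=> x [] y //= E.
  - by congr inl; apply: val_inj.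
  - by have := lf_notin y; rewrite -E (valP x).
  - by have := lf_notin x; rewrite E (valP y).
  - by congr inr; apply/eqP; rewrite -lfP -E lfP.
have [h gK hK] : bijective g.
  apply: (inj_card_bij g_inj).
  rewrite -cardsT -LS cardsU (disjoint_setI0 dLS) cards0 subn0.
  by rewrite card_sum !card_sig leq_add2r.
exists H; exists h; first by exists g.
by move=> x y; rewrite -gE !hK.
Qed.

Lemma unmixed_forest_K1_corona {G : sgraph} :
  acyclic G -> (forall x : G, exists y, edge x y) -> domination_unmixed G ->
  is_K1_corona G.
Proof.
move=> acG nisoG unmG.
have /fin_all_exists[nb nbE] := nisoG.
pose deg1 v := [forall w, edge v w ==> (w == nb v)].
have deg1P v w : deg1 v -> edge v w -> w = nb v.
  by move=> /forallP/(_ w)/implyP dv vw; apply/eqP/dv.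
(* In a component with two vertices both ends are leaves; the rank puts exactly
   one of them in [L]. *)
pose L := [set v | deg1 v & deg1 (nb v) ==> (enum_rank v < enum_rank (nb v))].
pose S := nb @: L.
have LP v w : v \in L -> edge v w -> w = nb v.
  by rewrite inE => /andP[dv _]; apply: deg1P.
have nbS v w : v \in L -> edge v w -> w \in S.
  by move=> vL /(LP v w vL)->; apply: imset_f.
have dLS : [disjoint L & S].
  apply/pred0P => v /=; apply/andP => -[vL /imsetP[l lL vl]].
  have lv := nbE l; rewrite -vl edge_sym in lv.
  have lE := LP v l vL lv; move: vL lL; rewrite !inE -lE -vl.
  move=> /andP[dv /implyP vl'] /andP[dl /implyP lv'].
  by have := ltn_trans (vl' dl) (lv' dv); rewrite ltnn.
have indL : independent L.
  apply/independentP => u v uL vL; apply/negP => /(nbS u v uL).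
  by rewrite (disjointFr dLS vL).
have SL s : s \in S -> exists2 l, l \in L & edge s l.
  by case/imsetP => l lL ->; exists l; rewrite // edge_sym.
have leSL : #|S| <= #|L| by apply: leq_imset_card.
pose R := ~: (L :|: S).
have RE v : (v \in R) = (v \notin L) && (v \notin S).
  by rewrite in_setC in_setU negb_or.
(* A leaf missing from [L] is adjacent to a leaf of smaller rank, which is in [L] and so puts it in
   [S]. *)
have deg1_notin v : deg1 v -> v \notin R.
  move=> dv; rewrite RE inE dv negb_and negbK /=.
  case: (boolP (deg1 (nb v))) => //= dnv.
  case: ltngtP => //= [lt|/val_inj/enum_rank_inj E].
    have vE : v = nb (nb v) by apply: (deg1P _ _ dnv); rewrite edge_sym.
    have : nb (nb v) \in S by rewrite imset_f // inE dnv -vE dv lt.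
    by rewrite -vE negbK.
  by have := nbE v; rewrite -E edge_irrefl.
(* Not being a leaf, [v] has a neighbour other than [r]. It is not in [R], nor in [L], since then
   [v] would be in [S]. *)
have R_S v r : v \in R -> {in R, forall u, edge v u -> u = r} ->
    exists2 s, s \in S & edge v s.
  move=> vR onlyr.
  have [y yDr vy] : exists2 y, y != r & edge v y.
    have := contraL (deg1_notin v) vR; case/forallPn => w.
    rewrite negb_imply => /andP[vw wDn].
    have [wr|wDr] := eqVneq w r; last by exists w.
    by exists (nb v); rewrite // -wr eq_sym.
  exists y => //; apply: contraTT vR => yNS.
  have [yL|yNL] := boolP (y \in L).
    by rewrite RE (nbS y) ?andbF // edge_sym.
  apply: contraNN yDr => vR; apply/eqP/onlyr => //.
  by rewrite RE yNL.
have [R0|[r0 r0R]] := set_0Vmem R.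
  have LS : L :|: S = setT by rewrite -[LHS]setCK -/R R0 setC0.
  have domL : dominating L.
    apply/dominatingP => v vNL; apply: SL.
    by have := in_setT v; rewrite -LS inE (negPf vNL).
  have domS : dominating S.
    apply/dominatingP => v vNS; exists (nb v) => //; apply: imset_f.
    by have := in_setT v; rewrite -LS inE (negPf vNS) orbF.
  apply: (pendant_matching_K1_corona (L := L) (S := S)) => //.
    by move=> l lL u v /(LP l u lL)-> /(LP l v lL)->.
  exact: unmixed_independent_le.
have [r rR degr] := acyclic_induced_deg_le1 acG r0R.
have RNL v : v \in R -> v \notin L by rewrite RE => /andP[].
have RNS v : v \in R -> v \notin S by rewrite RE => /andP[].
have LRN l v : l \in L -> v \in R -> ~~ edge l v.
  by move=> lL /RNS; apply: contraNN; apply: nbS.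
have [s sS rs] : exists2 s, s \in S & edge r s.
  have [/existsP[u /andP[uR ru]]|/existsPn rN] :=
      boolP [exists u, (u \in R) && edge r u].
    by apply: (R_S r u) => // v vR rv; apply: degr.
  (* With no neighbour of [r] in [R] the condition is vacuous, and [r] itself serves as the
     exception. *)
  by apply: (R_S r r) => // v vR rv; have := rN v; rewrite vR rv.
have indLU (W : {set G}) : W \subset R -> independent W -> independent (L :|: W).
  move=> /subsetP sWR /independentP indW; apply/independentP => u v.
  move=> /setUP[uL|uW] /setUP[vL|vW].
  - exact: (independentP indL).
  - by apply: LRN; rewrite ?sWR.
  - by rewrite edge_sym; apply: LRN; rewrite ?sWR.
  - exact: indW.
(* Once [r] is dropped, its neighbour in [R], if any, needs another dominator: a second neighbour
   [w] in [R], put into [W], or else one in [S] by [R_S]. *)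
have [W [sWR rW indW Wr]] : exists W : {set G}, [/\ W \subset R, r \in W,
    independent W & forall v, v \in R -> edge r v ->
      exists2 w, (w \in S) || (w \in W) && (w != r) & edge v w].
  have [/exists_inP[u uR /exists_inP[w wR /and3P[ru uw wDr]]]|noW] :=
      boolP [exists u in R, exists w in R, [&& edge r u, edge u w & w != r]].
    have rwN : ~~ edge r w.
      by apply: contraTN uw => rw; rewrite (degr u w) ?edge_irrefl.
    exists [set r; w]; split.
    - by apply/subsetP => z /set2P[]->.
    - by rewrite set21.
    - apply/independentP => a b /set2P[]-> /set2P[]->;
        by rewrite ?edge_irrefl // edge_sym.
    - move=> v vR rv; exists w; first by rewrite set22 wDr orbT.
      by rewrite (degr v u).
  exists [set r]; split; rewrite ?sub1set ?set11 //.
    by apply/independentP => a b /set1P-> /set1P->; rewrite edge_irrefl.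
  move=> v vR rv; have [|t tS vt] := R_S v r vR; last by exists t; rewrite ?tS.
  move=> w wR vw; apply: contraNeq noW => wDr.
  by apply/exists_inP; exists v => //; apply/exists_inP; exists w; rewrite ?rv ?vw.
have [I [/subsetP sI indI domI]] := independent_extension (indLU W sWR indW).
have rI : r \in I by apply: sI; rewrite in_setU rW orbT.
have domD : dominating (S :|: (I :\: (r |: L))).
  apply/dominatingP => v; rewrite inE negb_or => /andP[vNS vND].
  have [vL|vNL] := boolP (v \in L).
    by exists (nb v); rewrite // inE imset_f.
  have [->|vDr] := eqVneq v r; first by exists s; rewrite // inE sS.
  have vR : v \in R by rewrite RE vNL.
  have vNI : v \notin I.
    apply: contraNN vND => vI.
    by rewrite in_setD vI andbT in_setU1 negb_or vDr.
  have [i iI vi] := dominatingP domI v vNI.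
  have [ir|iDr] := eqVneq i r.
    have [|w wSW vw] := Wr v vR; first by rewrite edge_sym -ir.
    exists w; rewrite // in_setU; case/orP: wSW => [->//|/andP[wW wDr]].
    have wI : w \in I by apply: sI; rewrite in_setU wW orbT.
    by rewrite in_setD in_setU1 negb_or wDr wI RNL ?orbT // (subsetP sWR).
  exists i; rewrite // in_setU in_setD in_setU1 negb_or iDr iI andbT.
  have [iL|] := boolP (i \in L); last by rewrite orbT.
  by have := LRN i v iL vR; rewrite edge_sym vi.
have := unmixed_independent_le unmG indI domI domD.
(* Both sets share [I :\: (r |: L)]; the rest of [I] has [#|L| + 1] elements, against at most
   [#|S| <= #|L|]. *)
have sLI : r |: L \subset I.
  by apply/subsetP => z /setU1P[->//|zL]; rewrite sI // in_setU zL.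
rewrite leqNgt => /negP[]; apply: leq_ltn_trans (leq_card_setU _ _) _.
rewrite -[ltnRHS](cardsID (r |: L)) (setIidPr sLI) cardsU1 RNL // ltn_add2r.
by rewrite add1n ltnS.
Qed.

Theorem theorem3p12 (T : sgraph) (hT : is_tree T) (hcard : 1 < #|T|) :
  is_K1_corona T <-> domination_unmixed T.
Proof.
case: hT => _ connT acT; split; first exact: K1_corona_unmixed.
apply: unmixed_forest_K1_corona => // x.
(* No vertex is isolated: the path from [x] to a second vertex starts with an edge. *)
have [y yDx] : exists y, y != x.
  apply/existsP; apply: contraTT hcard => /existsPn xE.
  rewrite -leqNgt -(card1 x); apply/subset_leq_card/subsetP => y _.
  by rewrite inE -[_ == _]negbK xE.
case/connectP: (connT x y) => -[/= _ xy|z p /= /andP[xz _] _]; last by exists z.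
by rewrite xy eqxx in yDx.
Qed.
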